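(* Every weakly first-countable rectifiable space $G$ is metrizable.
   Context: All spaces are assumed to be $T_1$ and regular. A topological space $G$ is a rectifiable space if there are a surjective homeomorphism $\varphi: G\times G\to G\times G$ and an element $e\in G$ such that $\pi_1\circ\varphi=\pi_1$ and $\varphi(x,x)=(x,e)$ for every $x\in G$, where $\pi_1:G\times G\to G$ is the projection to the first coordinate. Let $\mathscr{P}=\bigcup_{x\in X}\mathscr{P}_x$ be a cover of a space $X$ such that for each $x\in X$: (a) if $U,V\in\mathscr{P}_x$ then $W\subset U\cap V$ for some $W\in\mathscr{P}_x$; (b) $x\in\bigcap\mathscr{P}_x$, and whenever $x\in U$ with $U$ open in $X$ there is $P\in\mathscr{P}_x$ with $P\subset U$. The family $\mathscr{P}$ is a weak base for $X$ if every set $A\subset X$ such that for each $x\in A$ there is $P\in\mathscr{P}_x$ with $P\subset A$ is open in $X$. The space $X$ is weakly first-countable if it has a weak base $\bigcup_{x\in X}\mathscr{P}_x$ with $\mathscr{P}_x$ countable for each $x\in X$. *)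

(* Defs.v *)
From HB Require Import structures.
From mathcomp Require Import all_boot all_order all_algebra.
From mathcomp Require Import all_classical all_reals all_analysis.

Set Implicit Arguments.
Unset Strict Implicit.
Unset Printing Implicit Defensive.

Local Open Scope classical_set_scope.

(* A homeomorphism of S onto T: bijectivity is part of the definition. *)
Definition homeomorphism (S T : topologicalType) (f : S -> T) : Prop :=
  continuous f /\
  exists g : T -> S, [/\ cancel f g, cancel g f & continuous g].

Definition rectifiable (G : topologicalType) : Prop :=
  exists (phi : G * G -> G * G) (e : G),
    [/\ homeomorphism phi,
        fst \o phi = fst &
        forall x : G, phi (x, x) = (x, e)].

(* The weak base is the union of the P x; the indexing by x is part of the
   data, since the clauses below refer to it. *)
Definition weak_base (X : topologicalType) (P : X -> set (set X)) : Prop :=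
  [/\ cover (\bigcup_x P x) id = [set: X],
      forall (x : X) (U V : set X), P x U -> P x V ->
        exists2 W, P x W & W `<=` U `&` V,
      forall x : X, (\bigcap_(U in P x) U) x,
      forall (x : X) (U : set X), open U -> U x ->
        exists2 W, P x W & W `<=` U &
      forall A : set X,
        (forall x, A x -> exists2 W, P x W & W `<=` A) -> open A].

Definition weakly_first_countable (X : topologicalType) : Prop :=
  exists2 P : X -> set (set X), weak_base P & forall x : X, countable (P x).

(* R is the field of real numbers in which distances take their values; X is
   metrizable when it is homeomorphic to a metric space. *)
Definition metrizable (R : realType) (X : topologicalType) : Prop :=
  exists (M : metricType R) (f : X -> M), homeomorphism f.

(* Main.v *)
Require Import Defs.
From mathcomp Require Import all_boot all_order all_algebra.
From mathcomp Require Import all_classical all_reals all_analysis.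
From HB Require Import structures.

Set Implicit Arguments.
Unset Strict Implicit.
Unset Printing Implicit Defensive.

(** A rectification phi with inverse psi gives two continuous operations,
    [q (x, y) = (phi (x, y)).2] and [p (x, y) = (psi (x, y)).2], which behave
    like [x^-1 * y] and [x * y]: [p (x, q (x, y)) = y], [q (x, x) = e] and
    [p (x, e) = x]. There is no associativity and no continuous inversion, so
    the usual proofs for topological groups have to be replaced.

    First countability. In a Hausdorff space, the members [V x k] of a
    decreasing countable weak base at x absorb the tail of every sequence that
    converges to x ([weak_base_sequential_nbhs]), and a set closed under limits
    of sequences is closed ([weak_base_seq_closed]). Let B be the set of limits
    of sequences in the complement A of [V e k]. If [x_ n] tends to x and each
    [x_ n] is a limit of points of A, then continuity of q allows choosing
    [y n] in A with [q (x_ n, y n)] in [V e n]; so [q (x_ n, y n)] tends to e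
    and [y n = p (x_ n, q (x_ n, y n))] tends to [p (x, e) = x]. Hence B is
    closed under limits and contains A, but it does not contain e: the set
    [V e k] is a neighbourhood of e ([weak_base_unit_nbhs]).

    Metrizability. The relations saying that [q (x, y)] and [q (y, x)] both lie
    in [V e k] are symmetric, and their sections [E x k] form a neighbourhood
    base at x. Symmetry stands in for inversion: if [E y k] meets [E x k] at z,
    then y is [p (z, q (z, y))] with z close to x and [q (z, y)] close to e, so
    y is close to x, and so is all of [E y k]. How large k has to be depends on
    x, so this is no uniformity, but it is the hypothesis of Frink's
    metrization theorem ([frink_metrizable]). That theorem is proved by picking
    at each point a subsequence of the base for which two intersecting members
    of one level lie in a single member of the previous level; the resulting
    covers generate a uniformity with a countable base. *)

Import Order.TTheory GRing.Theory Num.Theory.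
Local Open Scope classical_set_scope.

(** * Metrics from countable uniformities *)

Section metrization.
Local Open Scope ring_scope.
Local Open Scope relation_scope.

Section dist_space.
Context (R : realType) (X : choiceType) (d : X -> X -> R).
Hypothesis dxx : forall x, d x x = 0.
Hypothesis d0 : forall x y, d x y = 0 -> x = y.
Hypothesis dC : forall x y, d x y = d y x.
Hypothesis dD : forall y x z, d x z <= d x y + d y z.

(** The carrier X under a name of its own, so that the metric topology does not
    compete with a topology that X may already have; the hypotheses are kept in
    the body so that the name remembers which distance it stands for. *)
Definition dist_space : Type := let _ := (dxx, d0, dC, dD) in X.

HB.instance Definition _ := Choice.on dist_space.
HB.instance Definition _ := isMetric.Build R dist_space dxx d0 dC dD.

End dist_space.

Lemma metrizable_dist (R : realType) (X : topologicalType) (d : X -> X -> R) :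
  (forall x, d x x = 0) -> (forall x y, d x y = 0 -> x = y) ->
  (forall x y, d x y = d y x) -> (forall y x z, d x z <= d x y + d y z) ->
  (forall x, nbhs x = filter_from [set e | 0 < e] (fun e => [set y | d x y < e])) ->
  metrizable R X.
Proof.
move=> dxx d0 dC dD nbhsd.
pose M : metricType R := dist_space dxx d0 dC dD.
have nbhsM (x : M) : nbhs x = nbhs (x : X).
  by rewrite nbhsd -metricType_numDomainType.filter_from_mdist_nbhs.
exists M, (id : X -> M); split=> [x A|].
  by rewrite nbhsM.
by exists (id : M -> X); split=> // x A; rewrite nbhsM.
Qed.

(** The balls of a pseudometric structure need not be those of a distance; the
    infimum of the radii of the balls around x containing y is one that induces
    the same neighbourhoods. The bound r makes it finite. *)
Lemma bounded_pseudometric_metrizable (R : realType) (X : pseudoMetricType R)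
    (r : R) :
  0 < r -> (forall x y : X, ball x r y) -> hausdorff_space X -> metrizable R X.
Proof.
move=> r0 bX hX.
have efin (x y : X) : edist (x, y) \is a fin_num by apply/edist_finP; exists r.
apply: (@metrizable_dist R X (fun x y => fine (edist (x, y)))).
- by move=> x; rewrite edist_refl.
- move=> x y /eqP; rewrite -eqe fineK// => /eqP /edist_closeP.
  by rewrite closeE.
- by move=> x y; rewrite edist_sym.
- by move=> y x z; rewrite -lee_fin EFinD !fineK// edist_triangle.
move=> x; rewrite -filter_from_ballE; apply/seteqP.
split=> A [e /= e0 eA].
  exists e => // y /=; rewrite -lte_fin fineK// => /edist_lt_ball /=.
  exact: eA.
(* edist_fin bounds the distance non-strictly, so a smaller ball is needed *)
exists (e / 2) => /=; first by rewrite divr_gt0.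
move=> y yx; apply: eA; rewrite /= -lte_fin fineK//.
apply: (@le_lt_trans _ _ (e / 2)%:E).
  by apply: edist_fin => //; rewrite divr_gt0.
by rewrite lte_fin ltr_pdivrMr// ltr_pMr// ltr1n.
Qed.

Lemma countable_uniformity_metrizable (R : realType) (X : uniformType) :
  countable_uniformity X -> hausdorff_space X -> metrizable R X.
Proof.
move=> cX hX.
have := @bounded_pseudometric_metrizable R (countable_uniform.type cX) 2.
by apply=> // x y; exact: countable_uniform.countable_uniform_bounded.
Qed.

(** Alexandroff-Urysohn criterion: such a sequence generates a uniformity
    that has a countable base and induces the given topology. *)
Lemma uniform_base_metrizable (R : realType) (X : topologicalType)
    (A : nat -> set (X * X)) :
  (forall k, diagonal `<=` A k) ->
  (forall k, (A k)^-1 = A k) ->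
  (forall k, A k.+1 \; A k.+1 `<=` A k) ->
  (forall x, nbhs x = filter_from [set: nat] (fun k => xsection (A k) x)) ->
  hausdorff_space X -> metrizable R X.
Proof.
move=> Adiag Ainv Asplit nbhsA hX.
pose ent := filter_from [set: nat] A.
have AS k : A k.+1 `<=` A k.
  by move=> [x y] xy; apply: Asplit; exists y => //; exact: Adiag.
have Ale k l : (k <= l)%N -> A l `<=` A k.
  move=> /subnK <-; elim: (l - k)%N => [//|i ih]; rewrite addSn.
  by apply: subset_trans ih; exact: AS.
have entF : Filter ent.
  apply: filter_from_filter; first by exists 0%N.
  move=> k l _ _; exists (maxn k l) => // xy xyA.
  by split; apply: Ale xyA; rewrite ?leq_maxl ?leq_maxr.
have ent_diag B : ent B -> diagonal `<=` B.
  by move=> [k _ kB]; exact: subset_trans (Adiag k) kB.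
have ent_inv B : ent B -> ent B^-1.
  by move=> [k _ kB]; exists k => //; rewrite -Ainv => -[x y]; exact: kB.
have ent_split B : ent B -> exists2 C, ent C & C \; C `<=` B.
  move=> [k _ kB]; exists (A k.+1); first by exists k.+1.
  exact: subset_trans (Asplit k) kB.
have ent_nbhs : nbhs = nbhs_ ent :> (X -> _).
  apply/funext => x; rewrite nbhsA; apply/seteqP; split=> [B [k _ kB]|B].
    by exists (A k) => //; exists k.
  move=> [C [k _ kC] CB]; exists k => // y /xsectionP xy; apply: CB.
  by apply/xsectionP; exact: kC.
pose U : uniformType := HB.pack_for uniformType (Topological.sort X)
  (Topological.class X)
  (Nbhs_isUniform.Build X entF ent_diag ent_inv ent_split ent_nbhs).
have cU : countable_uniformity U.
  by apply/countable_uniformityP; exists A => [B [k _ kB]|k]; exists k.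
exact: (@countable_uniformity_metrizable R U cU hX).
Qed.

End metrization.

(** * Frink's metrization theorem *)

Section frink.

(** The maximum with the successor makes the index at least k, whatever m is, so
    that the thinned base still shrinks. *)
Fixpoint frink_index (m : nat -> nat) k : nat :=
  if k is k'.+1 then maxn (m (frink_index m k')) (frink_index m k').+1 else 0.

Lemma frink_index_ge m k : (k <= frink_index m k)%N.
Proof.
by elim: k => // k ih; rewrite /= leq_max; apply/orP; right.
Qed.

(** The index m may depend on x, so the sets [V x k] of one level k do not form a
    good cover. Thinning the base at each x separately, [W k.+1 x] is small
    enough to be absorbed: if [W k.+1 x] and [W k.+1 y] meet, then the one whose
    index in its own base is larger lies in the [W k] of the other point.
    Intersecting members of level k.+1 thus lie together in one member of level
    k, which is the composition law for the relations of lying in a common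
    member of level k. *)
Lemma frink_metrizable (R : realType) (X : topologicalType)
    (V : X -> nat -> set X) :
  (forall x k l, (k <= l)%N -> V x l `<=` V x k) ->
  (forall x, nbhs x = filter_from [set: nat] (V x)) ->
  (forall x n, exists m, forall y, V y m `&` V x m !=set0 -> V y m `<=` V x n) ->
  hausdorff_space X -> metrizable R X.
Proof.
move=> Vle nbhsV VP hX.
have [m mP] : exists m : X -> nat -> nat, forall x n y,
    V y (m x n) `&` V x (m x n) !=set0 -> V y (m x n) `<=` V x n.
  have /choice [m mP] (xn : X * nat) := VP xn.1 xn.2.
  by exists (fun x n => m (x, n)) => x n; exact: (mP (x, n)).
have Vxx x n : V x n x.
  by apply: (@nbhs_singleton X); rewrite nbhsV; exists n.
have mP' x n l y : (m x n <= l)%N ->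
    V y l `&` V x l !=set0 -> V y l `<=` V x n.
  move=> ml [z [yz xz]]; apply: (subset_trans (Vle _ _ _ ml)); apply: mP.
  by exists z; split; apply: Vle ml _ _.
pose W k x := V x (frink_index (m x) k).
have WS k x : W k.+1 x `<=` W k x.
  by apply: Vle => /=; rewrite leq_max leqnSn orbT.
have absorb k x y : (frink_index (m x) k.+1 <= frink_index (m y) k.+1)%N ->
    W k.+1 y `&` W k.+1 x !=set0 -> W k.+1 y `<=` W k x.
  move=> xy [z [yz xz]].
  apply: (subset_trans (Vle _ _ _ xy)); apply: mP'; first exact: leq_maxl.
  by exists z; split=> //; exact: Vle xy _ yz.
have merge k x y : W k.+1 x `&` W k.+1 y !=set0 ->
    exists z, W k.+1 x `|` W k.+1 y `<=` W k z.
  move=> xy; have [le|/ltnW le] := leqP (frink_index (m x) k.+1) (frink_index (m y) k.+1).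
    exists x; rewrite subUset; split; first exact: WS.
    by apply: absorb; rewrite 1?setIC.
  by exists y; rewrite subUset; split; [exact: absorb|exact: WS].
pose A k := [set xy : X * X | exists z, W k z xy.1 /\ W k z xy.2].
apply: (@uniform_base_metrizable R X A) => //.
- by move=> k [x _] /diagonalP <-; exists x; split; exact: Vxx.
- by move=> k; apply/seteqP; split=> -[x y] /= [z [? ?]]; exists z.
- move=> k [x y] /= [w [a [/= ax aw]] [b [/= bw by_]]].
  have [|z abz] := merge k a b; first by exists w.
  by exists z; split; apply: abz; [left|right].
move=> x; rewrite nbhsV; apply/seteqP; split=> B [n _ nB].
  (* any W l z with l >= m x n that contains x meets V x (m x n) at x *)
  exists (m x n) => // y /xsectionP /= [z [zx zy]]; apply: nB.
  apply: (mP' x n (m x n) z) => //; last first.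
    by apply: Vle zy; exact: frink_index_ge.
  by exists x; split => //; apply: Vle zx; exact: frink_index_ge.
exists (frink_index (m x) n) => // y xy; apply: nB.
by apply/xsectionP; exists x; split => //=; exact: Vxx.
Qed.

End frink.

(** * Countable weak bases and sequences *)

Section weak_bases.
Variable X : topologicalType.

Lemma T1_regular_hausdorff :
  accessible_space X -> regular_space X -> hausdorff_space X.
Proof.
move=> T1 reg x y xy; apply/eqP/negP => /negP /T1 [A [Ao]].
rewrite !inE => xA yA.
have /reg [B xB BA] : nbhs x A by exact: open_nbhs_nbhs.
by apply: yA; apply: BA => C yC; exact: xy.
Qed.

(** A countable weak base, replaced at each point by a decreasing sequence. *)
Definition weak_base_seq (V : X -> nat -> set X) : Prop :=
  [/\ forall x k, V x k x,
      forall x k l, (k <= l)%N -> V x l `<=` V x k,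
      forall x U, nbhs x U -> exists k, V x k `<=` U &
      forall A : set X, (forall x, A x -> exists k, V x k `<=` A) -> open A].

(** Finite intersections of an enumeration of P x need not belong to P x, but
    each contains a member of P x, which is all that the last clause needs. *)
Lemma weakly_first_countable_seq :
  weakly_first_countable X -> exists V, weak_base_seq V.
Proof.
move=> [P [_ PI Px Pnbhs Popen] cP].
have /choice [f fP] x : exists f : nat -> set X,
    (forall n, P x (f n)) /\ (forall U, P x U -> exists n, f n = U).
  have /pfcard_geP [P0|/unsquash f] := cP x.
    have [U PU] := Pnbhs x setT (@openT X) I.
    by rewrite P0 in PU.
  exists (f : nat -> set X); split=> [n|U PU]; first exact: funS.
  by have [n _ fn] := @surj _ _ _ _ f U PU; exists n.
pose V x n := \bigcap_(i in [set i | (i <= n)%N]) f x i.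
have VP x n : exists2 W, P x W & W `<=` V x n.
  elim: n => [|n [W PW WV]].
    by exists (f x 0%N); [exact: (fP x).1|move=> z z0 i /=; rewrite leqn0 => /eqP ->].
  have [W' PW' W'W] := PI x W (f x n.+1) PW ((fP x).1 _).
  exists W' => // z /W'W [zW zf] i /=; rewrite leq_eqVlt => /predU1P[-> //|].
  by rewrite ltnS => ilen; exact: WV.
exists V; split.
- by move=> x k i _; apply: Px; apply: (fP x).1.
- by move=> x k l kl z zV i /= ik; apply: zV; exact: leq_trans ik kl.
- move=> x U; rewrite nbhsE => -[U0 [U0o U0x] U0U].
  have [W PW WO] := Pnbhs x U0 U0o U0x; have [n fn] := (fP x).2 W PW.
  by exists n => z zV; apply: U0U; apply: WO; rewrite -fn; exact: (zV n (leqnn n)).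
move=> A AV; apply: Popen => x /AV [k VA].
by have [W PW WV] := VP x k; exists W => //; exact: subset_trans VA.
Qed.

Variable V : X -> nat -> set X.
Hypothesis VB : weak_base_seq V.

Lemma weak_base_cvg (x : X) (u : nat -> X) :
  (forall n, V x n (u n)) -> u @ \oo --> x.
Proof.
have [_ Vle Vnbhs _] := VB.
move=> Vu U /Vnbhs [k kU]; exists k => // n /= kn.
by apply: kU; apply: Vle kn _ (Vu n).
Qed.

(** The terms of u outside [V x k] form a set S whose complement is open by the
    weak base property: at x because [V x k] misses S, and at any other point
    because it is separated from a tail of u. As x is not in S, only finitely
    many terms of u lie in S. *)
Lemma weak_base_sequential_nbhs (x : X) (u : nat -> X) k :
  hausdorff_space X -> u @ \oo --> x -> \forall n \near \oo, V x k (u n).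
Proof.
have [Vx Vle Vnbhs Vopen] := VB.
move=> hX ux; pose S := [set y | ~ V x k y /\ exists n, u n = y].
have T1 := hausdorff_accessible hX.
have oS : open (~` S).
  apply: Vopen => y Sy; have [->|yx] := eqVneq y x.
    by exists k => z zV [].
  move: hX; rewrite open_hausdorff => /(_ _ _ yx) [[A B] /= []].
  rewrite !inE => yA xB [Ao Bo AB0].
  have [N _ NB] : \forall n \near \oo, B (u n).
    by apply: ux; exact: open_nbhs_nbhs.
  (* the terms of u in S that may still lie in A *)
  pose F := [set u i | i in [set i | (i < N)%N]] `&` S.
  have oF : open (~` F).
    rewrite openC; have [finite_closed _] := @accessible_finite_set_closed X.
    apply: (finite_closed T1 F); apply: finite_setIl; apply: finite_image.
    exact: finite_II.
  have [l lA] : exists l, V y l `<=` A `&` ~` F.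
    apply: Vnbhs; apply: filterI; first exact: open_nbhs_nbhs.
    by apply: open_nbhs_nbhs; split=> // -[].
  exists l => z /lA [zA zF] zS; apply: zF; split=> //.
  have [_ [n nz]] := zS; exists n => //=; rewrite ltnNge; apply/negP => Nn.
  have : (A `&` B) z by split=> //; rewrite -nz; exact: NB.
  by rewrite AB0.
have : \forall n \near \oo, ~ S (u n).
  apply: (ux (~` S)); apply: open_nbhs_nbhs.
  by split=> // -[nVx _]; exact: nVx (Vx x k).
apply: filterS => n Sn; apply: contrapT => nV; apply: Sn; split=> //.
by exists n.
Qed.

(** If no [V x n] avoids A, points chosen in [V x n] and A converge to x. *)
Lemma weak_base_seq_closed (A : set X) :
  (forall (u : nat -> X) x, (forall n, A (u n)) -> u @ \oo --> x -> A x) ->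
  closed A.
Proof.
have [Vx Vle Vnbhs Vopen] := VB.
move=> Aseq; rewrite -openC; apply: Vopen => x nAx; apply: contrapT.
move=> /forallNP nV; apply: nAx.
have /choice [u uP] n : exists y, V x n y /\ A y.
  apply: contrapT => /forallNP N; apply: (nV n) => y Vy Ay.
  by apply: (N y).
apply: (Aseq u); first by move=> n; case: (uP n).
by apply: weak_base_cvg => n; case: (uP n).
Qed.

End weak_bases.

(** * Rectifiable spaces *)

Section rectification.
Variable G : topologicalType.

Lemma continuous_cvg_pair (I : Type) (F : set_system I) (FF : Filter F)
    (h : G * G -> G) (f g : I -> G) (a b : G) :
  continuous h -> f @ F --> a -> g @ F --> b ->
  (fun i => h (f i, g i)) @ F --> h (a, b).
Proof.
move=> ch fa gb; apply: (@cvg_comp _ _ _ (fun i => (f i, g i)) h _ (nbhs (a, b))).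
  exact: cvg_pair.
exact: ch.
Qed.

(** Since phi preserves the first coordinate, it is determined by its second
    coordinate q, and its inverse by p. *)
Lemma rectifiable_operations : rectifiable G ->
  exists (p q : G * G -> G) (e : G),
  [/\ continuous p, continuous q,
      forall x y, p (x, q (x, y)) = y,
      forall x, q (x, x) = e & forall x, p (x, e) = x].
Proof.
move=> [phi [e [[cphi [psi [phiK psiK cpsi]]] fst_phi phixx]]].
have phi1 z : (phi z).1 = z.1 by move: (congr1 (fun f => f z) fst_phi).
have phiE x y : phi (x, y) = (x, (phi (x, y)).2).
  by rewrite [LHS]surjective_pairing phi1.
exists (snd \o psi), (snd \o phi), e; split=> /=.
- by move=> z; apply: continuous_comp; [exact: cpsi|exact: cvg_snd].
- by move=> z; apply: continuous_comp; [exact: cphi|exact: cvg_snd].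
- by move=> x y; rewrite -phiE phiK.
- by move=> x; rewrite phixx.
- by move=> x; rewrite -(phixx x) phiK.
Qed.

Variables (p q : G * G -> G) (e : G).
Hypotheses (cp : continuous p) (cq : continuous q).
Hypotheses (pqK : forall x y, p (x, q (x, y)) = y).
Hypotheses (qxx : forall x, q (x, x) = e) (pxe : forall x, p (x, e) = x).
Variable V : G -> nat -> set G.
Hypotheses (VB : weak_base_seq V) (hG : hausdorff_space G).

(** A diagonal choice, controlled by q and undone by p, shows that taking limits
    of sequences once already gives a closed set. Applied to the complement of
    [V e k], this leaves e outside the closure. *)
Lemma weak_base_unit_nbhs k : nbhs e (V e k).
Proof.
have [Vx Vle Vnbhs Vopen] := VB.
pose A := ~` V e k.
pose B := [set x : G | exists2 u : nat -> G, (forall n, A (u n)) & u @ \oo --> x].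
have cB : closed B.
  apply: (weak_base_seq_closed VB) => x_ x xB xx.
  have /choice [y yP] n : exists y, A y /\ V e n (q (x_ n, y)).
    have [u uA ux] := xB n.
    have qu : (fun i => q (x_ n, u i)) @ \oo --> e.
      rewrite -(qxx (x_ n)); apply: continuous_cvg_pair => //.
      exact: cvg_cst.
    have [i _ iV] := weak_base_sequential_nbhs VB n hG qu.
    by exists (u i); split=> //; exact: (iV i (leqnn i)).
  exists y; first by move=> n; case: (yP n).
  have qy : (fun n => q (x_ n, y n)) @ \oo --> e.
    by apply: (weak_base_cvg VB) => n; case: (yP n).
  have -> : y = (fun n => p (x_ n, q (x_ n, y n))).
    by apply/funext => n; rewrite pqK.
  by rewrite -(pxe x); exact: continuous_cvg_pair.
have nBe : ~ B e.
  move=> [u uA ue]; have [i _ iV] := weak_base_sequential_nbhs VB k hG ue.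
  exact: (uA i) (iV i (leqnn i)).
have : nbhs e (~` B) by apply: open_nbhs_nbhs; split => //; rewrite openC.
apply: filterS => x nBx; apply: contrapT => nVx; apply: nBx.
by exists (fun=> x) => //; exact: cvg_cst.
Qed.

Lemma rectification_nbhs_mul (x : G) (U : set G) : nbhs x U ->
  exists k, exists2 W, nbhs x W & forall y v, W y -> V e k v -> U (p (y, v)).
Proof.
have [Vx Vle Vnbhs Vopen] := VB.
rewrite -{1}(pxe x) => xU; have [[W W'] /= [xW eW'] WW'] := @cp (x, e) _ xU.
have [k kW'] := Vnbhs _ _ eW'.
by exists k; exists W => // y v Wy Vv; apply: (WW' (y, v)); split=> //; exact: kW'.
Qed.

(** Frink's condition for the symmetric relations E: a point w of [E y k] is
    reached from x in three steps x, z, y, w. The last two are controlled by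
    [Estep], the one from z to y after turning z in [E y k] into y in [E z k] by
    symmetry. *)
Lemma rectification_metrizable (R : realType) : metrizable R G.
Proof.
have [Vx Vle Vnbhs Vopen] := VB.
pose E (x : G) k := [set y : G | V e k (q (x, y)) /\ V e k (q (y, x))].
have EC x y k : E x k y -> E y k x by case.
have Ele x k l : (k <= l)%N -> E x l `<=` E x k.
  by move=> kl y [xy yx]; split; exact: Vle kl _ _.
have Enbhs x k : nbhs x (E x k).
  apply: filterI.
    have := @continuous_cvg_pair _ (nbhs x) _ q (fun=> x) id x x cq.
    rewrite qxx; apply=> //; [exact: cvg_cst|exact: weak_base_unit_nbhs].
  have := @continuous_cvg_pair _ (nbhs x) _ q id (fun=> x) x x cq.
  rewrite qxx; apply=> //; [exact: cvg_cst|exact: weak_base_unit_nbhs].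
have Estep (x : G) U : nbhs x U -> exists k, exists2 W, nbhs x W &
    forall y, W y -> E y k `<=` U.
  move=> /rectification_nbhs_mul [k [W xW WU]].
  by exists k, W => // y Wy z [yz _]; rewrite -(pqK y z); exact: WU.
have Ebase (x : G) U : nbhs x U -> exists k, E x k `<=` U.
  by move=> /Estep [k [W /nbhs_singleton Wx WU]]; exists k; exact: WU.
apply: (@frink_metrizable R G E) => //.
  move=> x; apply/seteqP; split=> U; first by move=> /Ebase [k]; exists k.
  by move=> [k _ kU]; apply: filterS kU _.
move=> x n.
have [k1 [W1 xW1 W1E]] := Estep x _ (Enbhs x n).
have [k2 [W2 xW2 W2W1]] := Estep x _ xW1.
have [k3 EW2] := Ebase x _ xW2.
exists (maxn k1 (maxn k2 k3)) => y [z [yz xz]] w yw.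
have Wz : W2 z by apply: EW2; apply: Ele xz; rewrite !leq_max leqnn !orbT.
have Wy : W1 y.
  by apply: (W2W1 z Wz); apply: Ele (EC _ _ _ yz); rewrite !leq_max leqnn !orbT.
by apply: (W1E y Wy); apply: Ele yw; rewrite leq_maxl.
Qed.

End rectification.

Theorem theorem3p7 (R : realType) (G : topologicalType)
  (G_T1 : @accessible_space G) (G_regular : @regular_space G)
  (G_rectifiable : rectifiable G) (G_wfc : weakly_first_countable G) :
  metrizable R G.
Proof.
have [p [q [e [cp cq pqK qxx pxe]]]] := rectifiable_operations G_rectifiable.
have [V VB] := weakly_first_countable_seq G_wfc.
have hG := T1_regular_hausdorff G_T1 G_regular.
exact: (rectification_metrizable cp cq pqK qxx pxe VB hG).
Qed.
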